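(* Fix a constant $c \in (0,1)$. There are arbitrarily large positive integers $J$ such that the following is true: there exist $N$ positive integers $1\leq j_1 < j_2 < \cdots < j_N < J$ with $N \geq J^{1-c}$ and a positive integer $$x\geq \exp\left(\frac{c^2}{5}\frac{(\log J)^2}{\log\log J}\right)$$ such that $$x(x+J)\prod_{i=1}^N (x+j_i)$$ is a perfect square. *)

(* Defs.v *)
From mathcomp Require Import all_boot all_order all_algebra.

Definition perfect_square (n : nat) : Prop := exists m : nat, n = m ^ 2.

(* Main.v *)
Require Import Defs.
From mathcomp Require Import all_boot all_order all_algebra.
From mathcomp Require Import all_classical all_reals all_analysis.
From mathcomp Require Import fintype finset zify ring lra.

(** Let p_n be the n-th prime, so that p_n <= 4 L (n + 1) for n < 2^L by
    Chebyshev's lower bound.  Multiply together one prime from each of the k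
    windows { p_n : 2^(L-i-1) <= n < 2^(L-i) }, i < k.  The T products obtained
    are distinct, because the windows are disjoint, and lie in [T, (8L)^k T].
    By pigeonhole some interval of length h = 2^(L+2) (8L)^k contains more than
    2^(L+1) of them.  They are supported on 2^L primes, so linear algebra over
    F_2 gives a subset with square product which misses at most 2^L of them.
    Its extreme elements are x and x + J, with 2^L <= J <= h and
    x >= T >= 2^(k(L-k)).  Finally k is the largest integer with
    (8L)^k <= 2^(cL); then J^(1-c) is at most about 2^((1-c^2)L), and the bound
    on x reduces to c^2 (1+c)^2 / 5 < c.

    Taking dyadic windows of indices, rather than of values, makes Chebyshev's
    lower bound the only information needed on the distribution of primes. *)

(** * Chebyshev's lower bound, from central binomial coefficients *)

Definition prime_count (y : nat) : nat := count prime (iota 0 y.+1).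

Lemma expn2_le_central_bin m : 2 ^ m <= 'C(m.*2, m).
Proof.
elim: m => [|m IHm] //.
rewrite doubleS binS expnS mul2n -addnn leq_add //.
  by rewrite (leq_trans IHm) // binS leq_addl.
by apply: (leq_trans IHm); rewrite -addn1 leq_bin2l ?addn1.
Qed.

(** Legendre's formula padded with vanishing terms, so that [m!] and [(2m)!] can be compared over
    one range of summation. *)
Lemma logn_fact_widen p m n : prime p -> m <= n ->
  logn p m`! = \sum_(1 <= k < n.+1) m %/ p ^ k.
Proof.
move=> p_pr le_mn; rewrite logn_fact //.
rewrite [RHS](big_cat_nat (n := m.+1)) //=.
rewrite [X in _ = _ + X]big1_seq ?addn0 // => k; rewrite mem_index_iota /=.
case/andP=> ltmk _; rewrite divn_small //.
exact: ltn_trans ltmk (ltn_expl _ (prime_gt1 p_pr)).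
Qed.

Lemma sum_leq_minn n e : \sum_(1 <= k < n.+1) (k <= e) = minn n e.
Proof.
elim: n => [|n IHn]; first by rewrite big_geq // min0n.
by rewrite big_nat_recr //= IHn; lia.
Qed.

(** By Legendre the exponent is the sum over k of floor(2m/p^k) - 2 floor(m/p^k). Each term is at
    most 1, and it vanishes once p^k > 2m. *)
Lemma pfactor_central_bin p m : prime p -> 0 < m ->
  p ^ logn p 'C(m.*2, m) <= m.*2.
Proof.
move=> p_pr m_gt0; have p_gt1 := prime_gt1 p_pr.
have m2_gt0 : 0 < m.*2 by rewrite double_gt0.
apply: leq_trans (trunc_logP p_gt1 m2_gt0); rewrite leq_exp2l //.
set e := trunc_log p m.*2.
have le_m : m <= m.*2 by rewrite -addnn leq_addl.
have := congr1 (logn p) (bin_fact le_m).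
have -> : m.*2 - m = m by rewrite -addnn addnK.
rewrite !lognM ?muln_gt0 ?fact_gt0 ?bin_gt0 //.
rewrite !(@logn_fact_widen p _ m.*2) //.
set S := (X in _ + (X + X)); move=> defS.
rewrite -(leq_add2r (S + S)) defS {defS}/S.
apply: (@leq_trans (\sum_(1 <= k < m.*2.+1)
           ((k <= e) + (m %/ p ^ k + m %/ p ^ k)))); last first.
  by rewrite !big_split leq_add2r sum_leq_minn geq_minr.
apply: leq_sum => k _; case: (leqP k e) => [_|lt_ek].
  by rewrite -addnn; have := leq_divDl (p ^ k) m m; lia.
by rewrite divn_small // (leq_trans (trunc_log_ltn _ p_gt1)) // leq_exp2l.
Qed.

Lemma central_bin_le_prime_count m : 0 < m ->
  'C(m.*2, m) <= m.*2 ^ prime_count m.*2.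
Proof.
move=> m_gt0; have m2_gt0 : 0 < m.*2 by rewrite double_gt0.
have C_gt0 : 0 < 'C(m.*2, m) by rewrite bin_gt0 -addnn leq_addl.
rewrite [X in X <= _]prod_prime_decomp // prime_decompE big_map /=.
set C := 'C(_, _).
apply: (@leq_trans (\prod_(p <- primes C) m.*2)).
  rewrite big_seq [X in _ <= X]big_seq; apply: leq_prod => p.
  by rewrite mem_primes => /andP[p_pr _]; apply: pfactor_central_bin.
rewrite big_const_seq count_predT iter_muln_1.
have -> : prime_count m.*2 = size [seq q <- iota 0 m.*2.+1 | prime q].
  by rewrite size_filter.
rewrite leq_pexp2l // uniq_leq_size ?primes_uniq // => p p_C.
move: (p_C); rewrite mem_primes => /and3P[p_pr _ p_dvd].
rewrite mem_filter p_pr mem_iota /= add0n ltnS.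
apply: (@leq_trans (p ^ logn p C)); last exact: pfactor_central_bin.
rewrite -[X in X <= _]expn1 leq_exp2l ?prime_gt1 //.
by rewrite -pfactor_dvdn // expn1.
Qed.

(** Take m = 2Lr in 2^m <= (2m)^pi(2m). The two upper bounds in the hypotheses give 2m = 4Lr <=
    2^(2L), so comparing exponents leaves r <= pi(4Lr). *)
Lemma prime_count_lower L r : 0 < L -> 0 < r <= 2 ^ L -> 4 * L <= 2 ^ L ->
  r <= prime_count (4 * L * r).
Proof.
move=> L_gt0 /andP[r_gt0 r_le] L_le.
have m_gt0 : 0 < 2 * L * r by rewrite !muln_gt0 L_gt0.
have defm : (2 * L * r).*2 = 4 * L * r by lia.
have := leq_trans (expn2_le_central_bin _) (central_bin_le_prime_count _ m_gt0).
rewrite {}defm => le1.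
have : 2 ^ (2 * L * r) <= 2 ^ (2 * L * prime_count (4 * L * r)).
  apply: (leq_trans le1); rewrite expnM.
  case: (posnP (prime_count (4 * L * r))) => [-> //|c_gt0]; rewrite leq_exp2r //.
  by rewrite mul2n -addnn expnD leq_mul.
by rewrite leq_exp2l // leq_pmul2l ?muln_gt0 //.
Qed.

(** * Enumeration of the primes *)

Lemma prime_count_unbounded n : exists y, n < prime_count y.
Proof.
elim: n => [|n [y lt_ny]]; first by exists 2.
have [p lt_yp p_pr] := prime_above y; exists p.
rewrite /prime_count -[p.+1]/(1 + p) addnC iotaD count_cat /= p_pr addn1 ltnS.
apply: leq_trans lt_ny _; rewrite -(subnKC lt_yp) iotaD count_cat leq_addr //.
Qed.

(** Indexed from 0. Defined by minimality, it turns a lower bound on [prime_count] into an upper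
    bound on a prime. *)
Definition nth_prime n := ex_minn (prime_count_unbounded n).

Lemma nth_prime_le n y : (nth_prime n <= y) = (n < prime_count y).
Proof.
rewrite /nth_prime; case: ex_minnP => m lt_nm min_m.
apply/idP/idP => [le_my|]; last exact: min_m.
apply: leq_trans lt_nm _; rewrite /prime_count.
by rewrite -(subnKC (n := y.+1) (m := m.+1)) // iotaD count_cat leq_addr.
Qed.

Lemma prime_countS y : prime_count y.+1 = prime_count y + prime y.+1.
Proof. by rewrite /prime_count -[in LHS]addn1 iotaD count_cat /= addn0. Qed.

Lemma prime_count_nth_prime n : prime_count (nth_prime n) = n.+1.
Proof.
have : n < prime_count (nth_prime n) by rewrite -nth_prime_le.
case defp: (nth_prime n) => [|y] //.
have : ~~ (n < prime_count y) by rewrite -nth_prime_le defp ltnn.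
by rewrite prime_countS; case: prime; lia.
Qed.

(** By minimality [prime_count] jumps at this value, and it jumps only at primes. *)
Lemma prime_nth_prime n : prime (nth_prime n).
Proof.
have : n < prime_count (nth_prime n) by rewrite -nth_prime_le.
case defp: (nth_prime n) => [|y] //.
have : ~~ (n < prime_count y) by rewrite -nth_prime_le defp ltnn.
by rewrite prime_countS; case: prime => //; lia.
Qed.

Lemma nth_prime_inj : injective nth_prime.
Proof.
by move=> m n /(congr1 prime_count); rewrite !prime_count_nth_prime => -[].
Qed.

Lemma leq_nth_prime n : n <= nth_prime n.
Proof.
rewrite -ltnS -prime_count_nth_prime.
by rewrite (leq_trans (count_size _ _)) // size_iota.
Qed.

(** * Products of one prime from each dyadic window of indices *)

(** The windows are disjoint and lie below 2^L only for [k <= L]: once L reaches 0, [L.-1] stays 0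
    and index 1 is repeated. *)
Fixpoint window_products k L : seq nat :=
  if k is k'.+1 then
    [seq nth_prime n * m | n <- iota (2 ^ L.-1) (2 ^ L.-1),
                           m <- window_products k' L.-1]
  else [:: 1].

(** For [k <= L] this is 2^((L-1) + ... + (L-k)). A window starting at 2^(L-1) also has 2^(L-1)
    indices, so the same number bounds the products from below. *)
Fixpoint window_product_count k L : nat :=
  if k is k'.+1 then 2 ^ L.-1 * window_product_count k' L.-1 else 1.

Lemma size_window_products k L :
  size (window_products k L) = window_product_count k L.
Proof. by elim: k L => //= k IHk L; rewrite size_allpairs size_iota IHk. Qed.

Lemma window_product_count_gt0 k L : 0 < window_product_count k L.
Proof. by elim: k L => //= k IHk L; rewrite muln_gt0 expn_gt0 IHk. Qed.

Lemma window_product_count_lower k L : k <= L ->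
  2 ^ (k * (L - k)) <= window_product_count k L.
Proof.
elim: k L => [|k IHk] [|L] //= le_kL; rewrite subSS.
apply: leq_trans (leq_mul (leqnn _) (IHk _ le_kL)); rewrite -expnD leq_exp2l //.
by rewrite mulSn leq_add2r leq_subr.
Qed.

Lemma window_products_gt0 k L m : m \in window_products k L -> 0 < m.
Proof.
elim: k L m => [|k IHk] L m /=; first by rewrite inE => /eqP->.
case/allpairsP=> -[n m'] /= [_ /IHk m'_gt0 ->].
by rewrite muln_gt0 m'_gt0 prime_gt0 ?prime_nth_prime.
Qed.

Lemma window_products_support k L m q : k <= L -> m \in window_products k L ->
  prime q -> q %| m -> exists2 i, i < 2 ^ L & q = nth_prime i.
Proof.
elim: k L m => [|k IHk] L m /=.
  by rewrite inE => _ /eqP-> q_pr; rewrite dvdn1 => /eqP q1; rewrite q1 in q_pr.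
case: L => // L le_kL /allpairsP[[n m'] /= [n_in m'_in ->]] q_pr.
rewrite Euclid_dvdM // => /orP[|q_dvd].
  rewrite dvdn_prime2 ?prime_nth_prime // => /eqP->; exists n => //.
  by move: n_in; rewrite mem_iota addnn -mul2n -expnS => /andP[].
have [i lt_i ->] := IHk _ _ le_kL m'_in q_pr q_dvd; exists i => //.
by rewrite (leq_trans lt_i) // leq_exp2l.
Qed.

(** The leading prime can be recovered from the product: its index is too large for it to divide the
    remaining factor of any product. *)
Lemma window_products_uniq k L : k <= L -> uniq (window_products k L).
Proof.
elim: k L => [|k IHk] [|L] //= le_kL.
apply: allpairs_uniq; [exact: iota_uniq | exact: IHk |].
have cop n m : n \in iota (2 ^ L) (2 ^ L) -> m \in window_products k L ->
    ~~ (nth_prime n %| m).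
  move=> n_in m_in; apply/negP=> p_dvd.
  have [i lt_i /nth_prime_inj eq_ni] :=
    window_products_support k L m _ le_kL m_in (prime_nth_prime n) p_dvd.
  by move: n_in; rewrite mem_iota eq_ni leqNgt lt_i.
move=> x y /allpairsP[[n m] /= [n_in m_in ->]].
move=> /allpairsP[[n' m'] /= [n'_in m'_in ->]] /= eq_nm.
have : nth_prime n %| nth_prime n' * m' by rewrite -eq_nm dvdn_mulr.
rewrite Euclid_dvdM ?prime_nth_prime // (negPf (cop _ _ n_in m'_in)) orbF.
rewrite dvdn_prime2 ?prime_nth_prime // => /eqP/nth_prime_inj eq_n.
move: eq_nm; rewrite eq_n => /eqP; rewrite eqn_pmul2l ?prime_gt0 ?prime_nth_prime //.
by move=> /eqP->.
Qed.

(** In a window of indices from 2^(L-1) to 2^L - 1, n <= p_n <= B(n+1) puts p_n between 2^(L-1) and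
    2B times 2^(L-1). *)
Lemma window_products_bounds B k L m : k <= L ->
    (forall n, n < 2 ^ L -> nth_prime n <= B * n.+1) ->
    m \in window_products k L ->
  window_product_count k L <= m <= B.*2 ^ k * window_product_count k L.
Proof.
elim: k L m => [|k IHk] L m /=; first by rewrite inE => _ _ /eqP->.
case: L => //= L le_kL B_up /allpairsP[[n m'] /= [n_in m'_in ->]].
have B_up' n0 : n0 < 2 ^ L -> nth_prime n0 <= B * n0.+1.
  by move=> lt_n0; rewrite B_up // (leq_trans lt_n0) // leq_exp2l.
have /andP[lo up] := IHk L m' le_kL B_up' m'_in.
move: n_in; rewrite mem_iota addnn -mul2n -expnS => /andP[le_n lt_n].
rewrite leq_mul ?(leq_trans le_n) ?leq_nth_prime //=.
rewrite expnS mulnACA leq_mul //.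
apply: leq_trans (B_up _ lt_n) _; rewrite -mul2n -mulnA mulnCA -expnS.
by rewrite leq_mul2l lt_n orbT.
Qed.

(** * Square subproducts by linear algebra over F_2 *)

Lemma even_logn_perfect_square n : 0 < n ->
  (forall p, prime p -> ~~ odd (logn p n)) -> perfect_square n.
Proof.
move=> n_gt0 even_n; exists (\prod_(p <- primes n) p ^ (logn p n)./2).
rewrite [LHS]prod_prime_decomp // prime_decompE big_map /= -mulnn -big_split /=.
rewrite big_seq [RHS]big_seq; apply: eq_bigr => p.
rewrite mem_primes => /andP[p_pr _]; rewrite -expnD addnn.
by rewrite -[in LHS](odd_double_half (logn p n)) (negPf (even_n p p_pr)).
Qed.

Lemma prod_disjoint_setU (T : finType) (F : T -> nat) (A B : {set T}) :
    [disjoint A & B] ->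
  \prod_(t in A :|: B) F t = (\prod_(t in A) F t) * \prod_(t in B) F t.
Proof.
by move=> disjAB; rewrite -bigU //; apply: eq_bigl => t; rewrite !inE.
Qed.

Section SquareSubproducts.

Variables (T : finType) (F : T -> nat) (M : nat) (p : nat -> nat).

Definition supported (U : {set T}) := forall t, t \in U ->
  0 < F t /\ forall q, prime q -> q %| F t -> exists2 i, i < M & q = p i.

(* There are more subsets than parity vectors of exponents; the symmetric
   difference of two subsets with equal parity vectors has a square product. *)
Lemma dependent_square (U : {set T}) : supported U -> M < #|U| ->
  exists V : {set T}, [/\ V \subset U, 0 < #|V|
    & perfect_square (\prod_(t in V) F t)].
Proof.
move=> suppU lt_MU.
pose par (B : {set T}) := [ffun i : 'I_M => odd (logn (p i) (\prod_(t in B) F t))].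
have /dinjectivePn[B1 B1U [B2 /andP[neqB B2U] eq_par]] :
    ~~ dinjectiveb par (powerset U).
  apply/negP => /dinjectiveP/leq_card_in.
  by rewrite card_powerset card_ffun card_bool card_ord leq_exp2l // leqNgt lt_MU.
move: B1U B2U; rewrite !powersetE => B1U B2U.
pose V := (B1 :\: B2) :|: (B2 :\: B1).
have VU : V \subset U.
  by rewrite subUset !(subset_trans (subsetDl _ _)).
have pos (B : {set T}) : B \subset U -> 0 < \prod_(t in B) F t.
  by move=> BU; apply: prodn_cond_gt0 => t tB; have [] := suppU _ (subsetP BU _ tB).
exists V; split=> //.
  rewrite card_gt0; apply: contraNneq neqB => V0.
  by rewrite eqEsubset -!setD_eq0 -!subset0 -!V0 subsetUr subsetUl.
apply: even_logn_perfect_square => [|q q_pr]; first exact: pos.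
have [q_dvd|] := boolP (q %| \prod_(t in V) F t); last first.
  by move=> /negPf nq; rewrite lognE nq !andbF.
have [i lt_i def_q] : exists2 i, i < M & q = p i.
  have /existsP[t /andP[tV q_t]] : [exists t, (t \in V) && (q %| F t)].
    apply: contraLR q_dvd => /existsPn no_t; apply/negP => q_dvd.
    suff: coprime q (\prod_(t in V) F t) by rewrite prime_coprime // q_dvd.
    elim/big_ind: _ => [|a b|t tV]; [exact: coprimen1 | by rewrite coprimeMr => -> |].
    by rewrite prime_coprime //; have := no_t t; rewrite tV.
  by have [_] := suppU _ (subsetP VU _ tV); apply.
(* Both products contain the factor over the intersection. Cancelling its parity leaves the two
   differences with equal parities, which add up to an even exponent. *)
have /ffunP/(_ (Ordinal lt_i)) := eq_par; rewrite !ffunE /= -def_q.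
rewrite (big_setID B2) [X in _ = odd (logn _ X)](big_setID B1) /= setIC.
have -> : \prod_(t in V) F t =
    (\prod_(t in B1 :\: B2) F t) * (\prod_(t in B2 :\: B1) F t).
  rewrite prod_disjoint_setU //.
  rewrite disjoint_subset; apply/subsetP=> t.
  by rewrite !inE => /andP[/negPf-> _]; rewrite andbF.
have subI : B2 :&: B1 \subset U by rewrite (subset_trans (subsetIl _ _)).
have subD1 : B1 :\: B2 \subset U by rewrite (subset_trans (subsetDl _ _)).
have subD2 : B2 :\: B1 \subset U by rewrite (subset_trans (subsetDl _ _)).
rewrite !lognM ?pos // !oddD.
by do 3!case: odd.
Qed.

(** Remove nonempty subsets with square product until at most [M] elements remain; the removed sets
    are disjoint, so their union works. *)
Lemma large_square_subset (U : {set T}) : supported U ->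
  exists S : {set T}, [/\ S \subset U, #|U| <= #|S| + M
    & perfect_square (\prod_(t in S) F t)].
Proof.
have [n] := ubnP #|U|; elim: n U => // n IHn U ltUn suppU.
have [le_UM|lt_MU] := leqP #|U| M.
  by exists (set0); rewrite sub0set cards0 big_set0; split=> //; exists 1.
have [V [VU V_gt0 [a Va]]] := dependent_square _ suppU lt_MU.
have cardU : #|V| + #|U :\: V| = #|U| by rewrite -(cardsID V U) (setIidPr VU).
have [||S [SU leS [b Sb]]] := IHn (U :\: V).
- by rewrite -(leq_add2l #|V|) addnS cardU; lia.
- by move=> t /setDP[tU _]; apply: suppU.
have disjVS : [disjoint V & S].
  rewrite disjoint_sym disjoint_subset; apply/subsetP => t /(subsetP SU).
  by rewrite !inE => /andP[].
exists (V :|: S); split.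
- by rewrite subUset VU (subset_trans SU) ?subsetDl.
- by rewrite cardsU disjoint_setI0 // cards0 subn0 -cardU -addnA leq_add2l.
- by exists (a * b); rewrite prod_disjoint_setU // Va Sb expnMn.
Qed.

End SquareSubproducts.

(** * Pigeonhole into a short interval, and its extreme elements *)

Lemma crowded_fiber (s : seq nat) (f : nat -> nat) n Q :
    {in s, forall a, f a < n} -> n * Q < size s ->
  exists2 q, q < n & Q < count (fun a => f a == q) s.
Proof.
move=> f_lt lt_size.
have [[q lt_q]|few] := pickP (fun q : 'I_n => Q < count (fun a => f a == q) s).
  by exists q.
suff : size s <= n * Q by rewrite leqNgt lt_size.
have -> : size s = \sum_(q < n) count (fun a => f a == q) s.
  under eq_bigr do rewrite -sum1_count big_mkcond.
  rewrite exchange_big /= -sum1_size big_seq [RHS]big_seq.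
  apply: eq_bigr => a /f_lt lt_fa.
  rewrite (bigD1 (Ordinal lt_fa)) //= eqxx big1 // => q.
  by rewrite -val_eqE /= eq_sym => /negPf->.
rewrite -[n in n * Q]card_ord -sum_nat_const; apply: leq_sum => q _.
by rewrite leqNgt few.
Qed.

Lemma square_product_in_short_interval L k :
    0 < L -> 4 * L <= 2 ^ L -> k <= L -> L.+2 < k * (L - k) ->
  exists r : seq nat, [/\ sorted ltn r, 2 ^ L < size r,
    {in r &, forall a b, a < b + 2 ^ L.+2 * (8 * L) ^ k},
    {in r, forall a, 2 ^ (k * (L - k)) <= a}
    & perfect_square (\prod_(a <- r) a)].
Proof.
move=> L_gt0 leL le_kL lt_kL.
set h := 2 ^ L.+2 * (8 * L) ^ k.
have h_gt0 : 0 < h by rewrite muln_gt0 !expn_gt0 muln_gt0 L_gt0.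
set s := window_products k L; set T := window_product_count k L.
have T_lo : 2 ^ (k * (L - k)) <= T by apply: window_product_count_lower.
have s_bnd a : a \in s -> T <= a <= (8 * L) ^ k * T.
  have -> : 8 * L = (4 * L).*2 by lia.
  apply: window_products_bounds => // n lt_n.
  by rewrite nth_prime_le prime_count_lower.
(* Numbers with the same quotient by [h] differ by less than [h]. *)
have [a||q _] := @crowded_fiber s (divn^~ h) ((8 * L) ^ k * T %/ h).+1 (2 ^ L.+1).
- by move=> /s_bnd/andP[_ up]; rewrite ltnS leq_div2r.
(* The full blocks account for at most T/2, and the extra one, due to the [.+1], for 2^(L+1) < T/2;
   this is where [L.+2 < k * (L - k)] enters. *)
- have lt_QT : 2 ^ L.+2 < T by apply: leq_trans T_lo; rewrite ltn_exp2l.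
  rewrite size_window_products -/T mulSn.
  have : (8 * L) ^ k * T %/ h * 2 ^ L.+2 <= T.
    rewrite -(leq_pmul2l (m := (8 * L) ^ k)) ?expn_gt0 ?muln_gt0 ?L_gt0 //.
    by rewrite mulnCA [X in _ * X]mulnC leq_divM.
  by rewrite -(leq_pmul2l (m := 2)) // in lt_QT *; rewrite !expnS in lt_QT *; nia.
rewrite -size_filter; set s' := [seq a <- s | _] => lt_size.
(* Passing to ordinals provides a finite type, and its enumeration is already increasing. *)
pose X := ((8 * L) ^ k * T).+1.
pose U := [set a : 'I_X | val a \in s'].
have s'_s a : a \in s' -> a \in s by rewrite mem_filter => /andP[].
have le_U : size s' <= #|U|.
  rewrite cardE -(size_map val); apply: uniq_leq_size.
    by rewrite filter_uniq // window_products_uniq.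
  move=> a a_s'; have /s_bnd/andP[_ up] := s'_s _ a_s'.
  have lt_aX : a < X by rewrite ltnS.
  by apply/mapP; exists (Ordinal lt_aX) => //; rewrite mem_enum inE.
have suppU : supported _ val (2 ^ L) nth_prime U.
  move=> a; rewrite inE => /s'_s a_s; split; first exact: window_products_gt0 a_s.
  by move=> p p_pr p_a; apply: window_products_support a_s p_pr p_a.
have [S [SU leS sqS]] := large_square_subset _ _ _ _ _ suppU.
have mem_r a : a \in [seq val i | i <- enum S] -> a \in s'.
  by move=> /mapP[i]; rewrite mem_enum => /(subsetP SU); rewrite inE => i_s' ->.
exists [seq val i | i <- enum S]; split.
- rewrite sorted_map /enum_mem.
  apply: sorted_filter => [a b c|]; first exact: ltn_trans.
  by rewrite -sorted_map -enumT val_enum_ord iota_ltn_sorted.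
- rewrite size_map -cardE -(ltn_add2r (2 ^ L)) addnn -mul2n -expnS.
  exact: leq_trans lt_size (leq_trans le_U leS).
- move=> a b /mem_r; rewrite mem_filter => /andP[/eqP qa _].
  move=> /mem_r; rewrite mem_filter => /andP[/eqP qb _].
  by rewrite (divn_eq a h) (divn_eq b h) qa qb -addnA ltn_add2l ltn_addl ?ltn_mod.
- by move=> a /mem_r/s'_s/s_bnd/andP[lo _]; apply: leq_trans lo.
- by rewrite big_map big_enum.
Qed.

Lemma sorted_endpoints (r : seq nat) N : sorted ltn r -> size r = N.+2 ->
  exists J x (j : 'I_N -> nat), [/\ x \in r /\ x + J \in r, N < J,
    forall i, 1 <= j i < J, forall a b : 'I_N, a < b -> j a < j b
    & \prod_(a <- r) a = x * (x + J) * \prod_(i < N) (x + j i)].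
Proof.
case: r => [|x r] // sorted_r; case/lastP: r sorted_r => [|t z] // sorted_r.
rewrite /= size_rcons => -[size_t].
move: (sorted_r); rewrite /= rcons_path => /andP[path_t _].
have x_lt a : a \in rcons t z -> x < a.
  by move: a; apply/allP/(order_path_min ltn_trans).
have lt_z a : a \in x :: t -> a < z.
  move: sorted_r; rewrite -rcons_cons -cats1 (sorted_pairwise ltn_trans) pairwise_cat.
  by case/and3P; rewrite allrel1r => /allP + _ _; apply.
have lt_xz : x < z by apply: lt_z; rewrite mem_head.
have sorted_t : sorted ltn t by apply: path_sorted path_t.
have nth_t (i : 'I_N) : nth 0 t i \in t by rewrite mem_nth ?size_t.
have nth_gt (i : 'I_N) : x < nth 0 t i by rewrite x_lt // mem_rcons inE nth_t orbT.
exists (z - x), x, (fun i => nth 0 t i - x); rewrite subnKC ?(ltnW lt_xz) //; split.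
- by rewrite mem_head inE mem_rcons mem_head orbT.
(* The interior entries are distinct integers strictly between [x] and [z]. *)
- have : size t <= size (iota x.+1 (z - x.+1)).
    apply: uniq_leq_size; first by move: sorted_t; rewrite ltn_sorted_uniq_leq => /andP[].
    move=> a a_t; rewrite mem_iota subnKC // x_lt ?mem_rcons ?inE ?a_t ?orbT //=.
    by rewrite lt_z // inE a_t orbT.
  by rewrite size_iota size_t; lia.
- move=> i; rewrite subn_gt0 nth_gt ltn_sub2r //.
  by rewrite lt_z // inE nth_t orbT.
- move=> a b lt_ab; apply: ltn_sub2r => //.
  by apply: (sorted_ltn_nth ltn_trans 0 sorted_t); rewrite ?inE ?size_t ?ltn_ord.
- rewrite big_cons big_rcons /= -mulnA; congr (_ * _); rewrite mulnC; congr (_ * _).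
  rewrite (big_nth 0) size_t big_mkord; apply: eq_bigr => i _.
  by rewrite subnKC // ltnW.
Qed.

(** * Real estimates and the choice of parameters *)

Set Implicit Arguments.
Unset Strict Implicit.

Import Order.TTheory GRing.Theory Num.Theory.
Local Open Scope ring_scope.

(* In the application [t = ln L], [a = ln 2] and [k + 1 > c L ln 2 / ln (8 L)]. *)
Lemma window_number_bounds (R : realFieldType) (c l t a k : R) :
    0 < c -> c < 1 -> 500 / c <= t -> t ^+ 2 / 4 <= l -> 1 / 2 <= a <= 1 ->
    0 <= k -> k * (t + 3 * a) <= c * l * a -> c * l * a < (k + 1) * (t + 3 * a) ->
  [/\ 100 * k <= l, 95 / 100 * (c * l * a) <= k * t, l + 2 < k * (l - k)
    & 3 <= c ^+ 2 * l].
Proof.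
move=> c0 c1 tc tl /andP[a1 a2] k0 kup klo.
have ct : 500 <= c * t by rewrite mulrC -ler_pdivrMr.
have t1 : 500 <= t by nra.
have l0 : 0 <= l by nra.
have cl : 125 * t <= c * l by nra.
have cl0 : 0 <= c * l by nra.
have cla : 60 * t <= c * l * a by nra.
(* The lost 5 percent covers [3 * a], small beside [t], and the rounding of [k], which costs about
   [t], at most a sixtieth of [c * l * a]. *)
have kt : 95 / 100 * (c * l * a) <= k * t by nra.
have kl : 100 * k <= l.
  have ktl : k * t <= l by nra.
  by nra.
have k50 : 50 <= k.
  have : 95 / 100 * 60 * t <= k * t by lra.
  by rewrite ler_pM2r; lra.
split=> //.
- have l2 : 2 <= l by nra.
  by move: kl k50 l2; clear; nra.
- have : (c * t) ^+ 2 <= 4 * (c ^+ 2 * l) by nra.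
  by nra.
Qed.

(** Used with [u] = ln J. Since (1-c)((1+c)l + 2) = (1-c^2)l + 2(1-c), the hypothesis
    [3 <= c ^+ 2 * l] absorbs the constants. *)
Lemma power_saving_bound (R : realFieldType) (c l a u : R) :
    0 < c -> c < 1 -> 0 <= a -> 3 <= c ^+ 2 * l -> u <= ((1 + c) * l + 2) * a ->
  (1 - c) * u <= (l - 1) * a.
Proof.
move=> c0 c1 a0 cl u1.
have : (1 - c) * u <= (1 - c) * (((1 + c) * l + 2) * a) by apply: ler_wpM2l; lra.
by move/le_trans; apply; rewrite mulrA; apply: ler_wpM2r => //; move: cl c0; clear; nra.
Qed.

(** Used with [u] = ln J and [v] = ln ln J. Bounding 1 + c by 2 and c^2 by c, the claim reduces to
    2.01^2 / 5 < 0.94 * 0.99, both sides multiplying c(la)^2. *)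
Lemma log_square_bound (R : realFieldType) (c l t a k u v : R) :
    0 < c -> c < 1 -> 500 <= t -> 500 <= l -> 1 / 2 <= a <= 1 ->
    0 <= k -> 100 * k <= l -> 95 / 100 * (c * l * a) <= k * t ->
    0 <= u <= ((1 + c) * l + 2) * a -> t - 1 <= v ->
  c ^+ 2 / 5 * (u ^+ 2 / v) <= k * (l - k) * a.
Proof.
move=> c0 c1 t1 l1 /andP[a1 a2] k0 kl kt /andP[u0 u1] tv.
have v0 : 0 < v by lra.
have a0 : 0 <= a by move: a1; clear; lra.
rewrite mulrA ler_pdivrMr //.
have u2 : u <= (2 * l + 2) * a.
  by apply: le_trans u1 _; apply: ler_wpM2r; [lra | nra].
have u3 : u <= 201 / 100 * (l * a) by nra.
have la0 : 0 <= l * a by nra.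
have u4 : u ^+ 2 <= (201 / 100 * (l * a)) ^+ 2 by rewrite !expr2; apply: ler_pM.
have c2 : c ^+ 2 <= c by nra.
have lhs : c ^+ 2 / 5 * u ^+ 2 <= c / 5 * (201 / 100 * (l * a)) ^+ 2.
  apply: ler_pM u4; [by rewrite divr_ge0 ?sqr_ge0 | exact: sqr_ge0 |].
  by move: c2; clear; lra.
apply: (le_trans lhs).
have cla0 : 0 <= c * l * a by nra.
have kv : 94 / 100 * (c * l * a) <= k * v.
  have : k * (t * (99 / 100)) <= k * v by apply: ler_wpM2l => //; lra.
  by lra.
have : 94 / 100 * (c * l * a) * (99 / 100 * (l * a)) <= k * v * ((l - k) * a).
  apply: (ler_pM _ _ kv); [by move: cla0; clear; lra | by move: la0; clear; lra |].
  by rewrite mulrA; apply: ler_wpM2r; [exact: a0 | move: kl; clear; lra].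
have : 0 <= c * (l * a) ^+ 2 by rewrite mulr_ge0 ?sqr_ge0 ?ltW.
by clear; nra.
Qed.

(** Both bounds are ln(1+x) <= x, at x = -1/2 and x = 1. *)
Lemma ln2_bounds (R : realType) : 1 / 2 <= ln (2 : R) <= 1.
Proof.
apply/andP; split.
  have := @le_ln1Dx R (- (1 / 2)); have -> : 1 + - (1 / 2) = (2 : R)^-1 by field.
  by rewrite lnV ?posrE //; lra.
by have := @le_ln1Dx R 1; have -> : 1 + 1 = (2 : R) by []; lra.
Qed.

Lemma sqr_ln_le (R : realType) (x : R) : 1 <= x -> ln x ^+ 2 / 4 <= x.
Proof.
move=> x1; have x0 : 0 < x by lra.
have t0 : 0 <= ln x by rewrite ln_ge0.
have defx : expR (ln x / 2) ^+ 2 = x by rewrite -expRM_natl mulrC divfK ?lnK ?posrE.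
have -> : ln x ^+ 2 / 4 = (ln x / 2) ^+ 2 by field.
rewrite -[leRHS]defx lerXn2r ?nnegrE ?expR_ge0 ?divr_ge0 //.
by have := expR_ge1Dx (ln x / 2); lra.
Qed.

Lemma leq_mul4_exp2 L : (4 <= L)%N -> (4 * L <= 2 ^ L)%N.
Proof.
elim: L => // L IHL; rewrite leq_eqVlt => /orP[/eqP<- //|le4L].
by have := IHL le4L; rewrite expnS; lia.
Qed.

(** The pigeonhole argument locates J only within a range, so both estimates are required throughout
    it. *)
Lemma exists_window_parameters (R : realType) (c : R) (J0 : nat) :
    0 < c -> c < 1 ->
  exists L k : nat, [/\ (J0 <= L)%N, (0 < L)%N /\ (4 * L <= 2 ^ L)%N, (k <= L)%N,
    (L.+2 < k * (L - k))%N
    & forall J : nat, (2 ^ L <= J <= 2 ^ L.+2 * (8 * L) ^ k)%N ->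
      (J%:R : R) `^ (1 - c) <= (2 ^ L.-1)%:R /\
      expR (c ^+ 2 / 5 * (ln (J%:R : R) ^+ 2 / ln (ln (J%:R : R))))
        <= (2 ^ (k * (L - k)))%:R].
Proof.
move=> c0 c1.
(* Exceeding exp(500/c) gives [500 / c <= t]; the added 4 gives [4 * L <= 2 ^ L]. *)
pose L := (maxn J0 (Num.bound (expR (500 / c))) + 4)%N.
have le_J0 : (J0 <= L)%N by apply: leq_trans (leq_maxl J0 _) (leq_addr _ _).
have leL : (4 <= L)%N by rewrite leq_addl.
set l := (L%:R : R); set t := ln l; set a := ln (2 : R).
have l_gt : expR (500 / c) < l.
  apply: lt_le_trans (archi_boundP (expR_ge0 _)) _.
  by rewrite ler_nat; apply: leq_trans (leq_maxr J0 _) (leq_addr _ _).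
have l0 : 0 < l by apply: lt_trans l_gt; rewrite expR_gt0.
have tc : 500 / c <= t by rewrite -(expRK (500 / c)) ler_ln ?posrE ?expR_gt0 // ltW.
have c500 : 500 <= 500 / c by rewrite ler_pdivlMr //; lra.
have t500 : 500 <= t by lra.
have l1 : 1 <= l by rewrite ler1n (leq_trans _ leL).
have tl : t ^+ 2 / 4 <= l by apply: sqr_ln_le.
have l500 : 500 <= l by nra.
have a_bnd : 1 / 2 <= a <= 1 := ln2_bounds R.
have [a1 a2] := andP a_bnd.
have a0 : 0 < a by move: a1; clear; lra.
have la0 : 0 < l * a by rewrite mulr_gt0.
have ta0 : 0 < t + 3 * a by lra.
have cla0 : 0 <= c * l * a / (t + 3 * a) by rewrite divr_ge0 ?mulr_ge0 ?ltW.
(* Here [t + 3 * a] is ln(8L), so [k] is the largest integer with (8L)^k <= 2^(cL). *)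
pose k := Num.truncn (c * l * a / (t + 3 * a)).
have /andP[] := truncn_itv cla0; rewrite -/k ler_pdivlMr // ltr_pdivrMr // -[k.+1%:R]natr1.
move=> k_up k_lo; set kR := (k%:R : R) in k_up k_lo.
have kR0 : 0 <= kR by rewrite ler0n.
have [kl kt kl2 cl3] := window_number_bounds c0 c1 tc tl a_bnd kR0 k_up k_lo.
have le_kL : (k <= L)%N by rewrite -(ler_nat R) -/l -/kR; move: kl kR0; clear; lra.
have ln_pow2 n : ln ((2 ^ n)%:R : R) = n%:R * a.
  by rewrite natrX lnXn // mulr_natl.
have expR_pow2 n : ((2 ^ n)%:R : R) = expR (n%:R * a).
  by rewrite -ln_pow2 lnK // posrE ltr0n expn_gt0.
exists L, k; split=> //.
- by split; [exact: leq_trans leL | exact: leq_mul4_exp2].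
- by rewrite -(ltr_nat R) natrM natrB // -/l -/kR -[L.+2]addn2 natrD.
move=> J /andP[J_lo J_up].
have J0' : 0 < (J%:R : R) by rewrite ltr0n (leq_trans _ J_lo) ?expn_gt0.
set u := ln (J%:R : R).
have u_lo : l * a <= u by rewrite -ln_pow2 ler_ln ?posrE // ?ler_nat // ltr0n expn_gt0.
have u_up : u <= ((1 + c) * l + 2) * a.
  have : u <= ln ((2 ^ L.+2 * (8 * L) ^ k)%:R : R).
    by rewrite ler_ln ?posrE // ?ler_nat // ltr0n (leq_trans _ J_up) // -(ltr0n R).
  have L0 : (0 < L)%N by exact: leq_trans leL.
  rewrite natrM lnM ?posrE ?ltr0n ?expn_gt0 ?muln_gt0 ?L0 // ln_pow2.
  rewrite natrX lnXn ?ltr0n ?muln_gt0 ?L0 // natrM lnM ?posrE //.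
  have -> : (8 : R) = (2 ^ 3)%:R by [].
  rewrite ln_pow2 -/l -/t -mulr_natl -/kR -[L.+2]addn2 natrD -/l.
  by move: k_up; rewrite -/l; clear; lra.
have u0 : 0 < u by apply: lt_le_trans u_lo.
split.
  rewrite /powR gt_eqF // -/u expR_pow2 ler_expR.
  have -> : (L.-1%:R : R) = l - 1 by rewrite -subn1 natrB //; exact: leq_trans leL.
  exact: power_saving_bound c0 c1 (ltW a0) cl3 u_up.
rewrite expR_pow2 ler_expR natrM natrB // -/l -/kR.
apply: (log_square_bound c0 c1 t500 l500 a_bnd kR0 kl kt); first by rewrite u_up ltW.
(* ln ln J >= ln l + ln a >= t - ln 2 >= t - 1, using a >= 1/2. *)
have : ln (l * a) <= ln u by rewrite ler_ln ?posrE.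
apply: le_trans; rewrite lnM ?posrE //.
have : ln ((2 : R)^-1) <= ln a by rewrite ler_ln ?posrE //; move: a1; clear; lra.
by rewrite lnV ?posrE // -/t -/a; move: a2; clear; lra.
Qed.

Theorem theorem1p3 (R : realType) (c : R) (hc0 : 0 < c) (hc1 : c < 1) :
  forall J0 : nat, exists2 J : nat, (J0 < J)%N &
  exists (N : nat) (j : 'I_N -> nat) (x : nat),
    [/\ forall i : 'I_N, (1 <= j i < J)%N,
        forall a b : 'I_N, (a < b)%N -> (j a < j b)%N,
        (J%:R : R) `^ (1 - c) <= N%:R,
        (0 < x)%N /\
          expR (c ^+ 2 / 5 * (ln (J%:R : R) ^+ 2 / ln (ln (J%:R : R))))
            <= x%:R &
        perfect_square (x * (x + J) * \prod_(i < N) (x + j i))%N].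
Proof.
move=> J0.
have [L [k [le_J0 [L_gt0 leL] le_kL lt_kL J_bnd]]] := exists_window_parameters J0 hc0 hc1.
have [r [sorted_r lt_r width_r lo_r sq_r]] :=
  square_product_in_short_interval _ _ L_gt0 leL le_kL lt_kL.
(* N is at least 2^L - 1, hence at least 2^(L-1); and N < J then gives back J >= 2^L. *)
have L_half : (2 ^ L = 2 ^ L.-1 + 2 ^ L.-1)%N by rewrite addnn -mul2n -expnS prednK.
have half_gt0 : (0 < 2 ^ L.-1)%N by rewrite expn_gt0.
have [|J [x [j [[x_r xJ_r] lt_NJ j_bnd j_lt prod_r]]]] :=
  @sorted_endpoints r (size r - 2) sorted_r; first by lia.
have J_lo : (2 ^ L <= J)%N by apply: leq_trans lt_NJ; lia.
have J_up : (J <= 2 ^ L.+2 * (8 * L) ^ k)%N.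
  by rewrite -(leq_add2l x) ltnW // width_r.
have [JN Jx] := J_bnd J (introT andP (conj J_lo J_up)).
exists J; first by apply: leq_ltn_trans le_J0 (leq_trans (ltn_expl L _) J_lo).
exists (size r - 2)%N, j, x; split=> //.
- by apply: le_trans JN _; rewrite ler_nat; lia.
- split; first by apply: leq_trans (lo_r _ x_r); rewrite expn_gt0.
  by apply: le_trans Jx _; rewrite ler_nat lo_r.
- by rewrite -prod_r.
Qed.
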